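(* Let $G$ be a finite group. If $V$ and $W$ are two faithful finite-dimensional $\mathbb{C}G$-modules such that $Z_V(G)=Z_W(G)$, then $c_V(n)=c_W(n)$ for all $n$.
   Context: For a faithful finite-dimensional $\mathbb{C}G$-module $V$, $Z_V(G)$ is the subgroup of all $g\in G$ acting on $V$ by a scalar, and $\omega_V(g)$ denotes that scalar; since $V$ is faithful, $Z_V(G)$ is contained in the center of $G$. Let $\chi_1,\dots,\chi_N$ be the irreducible complex characters of $G$ and $S_g=\sum_{i=1}^N\chi_i(g)$ the sum of the entries of the column of the character table corresponding to $g$. Define $$c_V(n)=\frac{1}{|G|}\sum_{g\in Z_V(G)}S_g\,\omega_V(g)^n .$$ (The asymptotic growth rate of the number of irreducible summands in $V^{\otimes n}$ is $a(n)=c_V(n)\cdot(\dim V)^n$.) *)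

(* Defs.v *)
From mathcomp Require Import all_boot all_order all_fingroup all_algebra.
From mathcomp Require Import mxrepresentation.
From mathcomp Require Import reals.
From mathcomp Require Import complex.

Set Implicit Arguments.
Unset Strict Implicit.
Unset Printing Implicit Defensive.

Import GRing.Theory.
Local Open Scope ring_scope.

Section GrowthRate.
Variables (R : realType) (gT : finGroupType) (G : {group gT}).

(* The irreducible CG-modules up to isomorphism are indexed by the Wedderburn
   components of the regular representation. *)
Definition irrC : irrType R[i] G := DecSocleType (regular_repr R[i] G).

Definition irr_char (i : irrC) (g : gT) : R[i] := \tr (irr_repr i g).

Definition char_col_sum (g : gT) : R[i] := \sum_(i : irrC) irr_char i g.

Variables (m : nat) (V : mx_representation R[i] G m).

(* For g in the scalar subgroup [rcenter V], the scalar by which g acts, read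
   off the first diagonal entry as in [is_scalar_mx].  For the zero module,
   where the scalar is not determined, it is 1 by convention. *)
Definition omega (g : gT) : R[i] :=
  if insub 0%N is Some i then V g i i else 1.

Lemma omegaP g : g \in rcenter V -> V g = (omega g)%:M.
Proof.
rewrite inE /is_scalar_mx /omega => /andP[_].
case: insubP => [i _ _ /eqP // | ]; rewrite -eqn0Ngt => /eqP m0 _.
by apply/matrixP => i; have := ltn_ord i; rewrite {2}m0.
Qed.

Lemma omega_uniq g c : (0 < m)%N -> V g = c%:M -> omega g = c.
Proof.
by move=> m_gt0 Vg; rewrite /omega insubT Vg mxE eqxx.
Qed.

Definition growth_coef (n : nat) : R[i] :=
  #|G|%:R^-1 * \sum_(g in rcenter V) char_col_sum g * omega g ^+ n.

End GrowthRate.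

(* Main.v *)
From HB Require Import structures.
Require Import Defs.
From mathcomp Require Import all_boot all_order all_fingroup all_algebra.
From mathcomp Require Import all_solvable all_field.
From mathcomp Require Import mxrepresentation classfun character.
From mathcomp Require Import reals.
From mathcomp Require Import complex.

Set Implicit Arguments.
Unset Strict Implicit.
Unset Printing Implicit Defensive.

Import GRing.Theory Num.Theory.
Local Open Scope ring_scope.

(** Write Z for the common subgroup of scalar elements.  As V and W are
    faithful, the scalar characters omega_V and omega_W are injective
    homomorphisms from Z to C^*, so Z is cyclic, and both send a generator of
    order r to a primitive r-th root of unity.  Hence omega_W = omega_V ^ k for
    some k coprime to r ([omega_coprime_exp]), and g |-> g ^ k permutes Z.  It
    remains to know that the column sums satisfy S_(g ^ k) = S_g for g in Z
    ([char_col_sum_expg]); then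
      sum_g S_g omega_W(g)^n = sum_g S_(g ^ k) omega_V(g ^ k)^n
                             = sum_g S_g omega_V(g)^n.

    The identity S_(g ^ k) = S_g is Galois invariance.  Over the algebraic
    numbers ([sum_irr_expg]), an automorphism u raising the roots of unity of
    order dividing #[g] to the power k sends chi(g) to chi(g ^ k) for every
    character chi, while it permutes the irreducible characters.

    To carry this over to another algebraically closed field F of
    characteristic 0, such as C, note that the finitely many matrix entries of
    the irreducible representations over the algebraic numbers lie in a number
    field K, which also embeds in F ([num_field_embedding]).  The
    representations thus descend to K ([descend_repr]) and, extended to F, give
    all the irreducible representations over F: they are absolutely
    irreducible, their characters are distinct, and there are as many of them
    as conjugacy classes ([sum_irr_mxtrace]).  So both column sums, over the
    algebraic numbers and over F, are images of the same element of K. *)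

(** * Number fields inside an algebraically closed field *)

(** By the primitive element theorem s lies in some K = Q(z1), and K embeds in F
    by sending z1 to any root w in F of its minimal polynomial over Q. *)
Lemma num_field_embedding (s : seq algC) (F : numClosedFieldType) :
  {K : fieldExtType rat & {KC : {rmorphism K -> algC}
     & {_ : {rmorphism K -> F} | {in s, forall a, exists b, KC b = a}}}}.
Proof.
have [z _ /sig_eqW[ps Ds]] := algC_PET s.
have [K [KC [[|z1 []] //= [Dz1] genK]]] := num_field_exists [:: z].
rewrite adjoin_seq1 in genK.
have gen y : {q : {poly rat} | fieldExt_horner z1 q = y}.
  apply: sig_eqW; have /Fadjoin1_polyP[q ->]: y \in <<1; z1>>%VS.
    by rewrite genK memvf.
  by exists q.
have [p Dp] : {p : {poly rat} | map_poly (in_alg K) p == minPoly 1 z1}.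
  by apply: sigW; have /polyOver1P[p ->] := minPolyOver 1 z1; exists p.
have [w pw0] : {w : F | root (map_poly ratr p) w}.
  apply: sigW; apply/closed_rootP; rewrite size_map_poly.
  rewrite -(size_map_poly (in_alg K)) (eqP Dp) neq_ltn.
  rewrite (root_size_gt1 _ (root_minPoly 1 z1)) ?orbT //.
  by rewrite monic_neq0 ?monic_minPoly.
(* Both K and its image in F are quotients of the rational polynomials: q.[z1]
   is sent to q.[w]. *)
pose ev q := (map_poly ratr q : {poly F}).[w].
have evP q1 q2 : fieldExt_horner z1 q1 = fieldExt_horner z1 q2 -> ev q1 = ev q2.
  move/eqP; rewrite -subr_eq0 -rmorphB => q0.
  have: p %| q1 - q2.
    rewrite -(dvdp_map (in_alg K)) (eqP Dp) minPoly_dvdp //.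
    by apply/polyOver1P; exists (q1 - q2).
  case/dvdpP=> d Dq; apply/eqP; rewrite -subr_eq0 /ev -hornerN -hornerD.
  by rewrite -rmorphB Dq rmorphM hornerM (rootP pw0) mulr0.
pose g y := ev (sval (gen y)).
have gE q : g (fieldExt_horner z1 q) = ev q by apply: evP; case: (gen _).
have gB : zmod_morphism g.
  move=> x y; have [[q1 <-] [q2 <-]] := (gen x, gen y).
  by rewrite -rmorphB !gE /ev rmorphB hornerD hornerN.
have gM : monoid_morphism g.
  split=> [|x y].
    by rewrite -(rmorph1 (fieldExt_horner z1)) gE /ev rmorph1 hornerC.
  have [[q1 <-] [q2 <-]] := (gen x, gen y).
  by rewrite -rmorphM !gE /ev rmorphM hornerM.
pose gBM := GRing.isZmodMorphism.Build _ _ g gB.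
pose gMM := GRing.isMonoidMorphism.Build _ _ g gM.
exists K, KC, (HB.pack g gBM gMM : {rmorphism K -> F}) => a.
rewrite {1}Ds => /mapP[q _ ->]; exists (fieldExt_horner z1 q).
rewrite /= -horner_map Dz1 -map_poly_comp; congr _.[z].
by apply: eq_map_poly => b /=; rewrite alg_num_field fmorph_rat.
Qed.

(** * Sums of irreducible characters *)

Lemma descend_repr (K F : fieldType) (f : {rmorphism K -> F})
    (gT : finGroupType) (G : {group gT}) (n : nat)
    (rG : mx_representation F G n) :
    (forall x i j, exists b, f b == rG x i j) ->
  {rK : mx_representation K G n | forall x, map_mx f (rK x) = rG x}.
Proof.
move=> ex_b; pose r x := \matrix_(i, j) xchoose (ex_b x i j).
have fr x : map_mx f (r x) = rG x.
  by apply/matrixP=> i j; rewrite !mxE; apply/eqP/(xchooseP (ex_b x i j)).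
have r_repr : mx_repr G r.
  split=> [|x y Gx Gy]; apply: (map_mx_inj (f := f)).
    by rewrite fr repr_mx1 map_mx1.
  by rewrite map_mxM !fr repr_mxM.
by exists (MxRepresentation r_repr).
Qed.

(** Over a splitting field there are as many isomorphism classes of irreducible
    representations as conjugacy classes.  So a family of that many irreducible
    representations with pairwise distinct characters meets each isomorphism
    class exactly once, and can replace the Wedderburn components as index
    set. *)
Lemma sum_irr_mxtrace (F : fieldType) (gT : finGroupType) (G : {group gT})
    (sG : irrType F G) (I : finType) (n_ : I -> nat)
    (rG : forall i, mx_representation F G (n_ i)) :
    [pchar F]^'.-group%g G -> group_splitting_field F G ->
    (forall i, mx_irreducible (rG i)) ->
    (forall i j, {in G, forall x, \tr (rG i x) = \tr (rG j x)} -> i = j) ->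
    #|I| = #|classes G| ->
  {in G, forall x, \sum_(j : sG) \tr (irr_repr j x) = \sum_i \tr (rG i x)}.
Proof.
move=> F'G splitG irrG tr_inj cardI x Gx.
pose h i : sG := irr_comp sG (rG i).
have trh i : {in G, forall y, \tr (rG i y) = \tr (irr_repr (h i) y)}.
  exact/mxtrace_rsim/rsim_irr_comp_pchar.
have inj_h : injective h.
  by move=> i j eq_h; apply: tr_inj => y Gy; rewrite !trh // eq_h.
rewrite (reindex h); last first.
  by apply: onW_bij; apply: inj_card_bij; rewrite // cardI card_irr_pchar.
by apply: eq_bigr => i _; rewrite trh.
Qed.

(** The automorphism u of the algebraic numbers that acts as e |-> e ^+ k on
    the #[x]-th roots of unity maps chi x to chi (x ^+ k), since the restriction
    of chi to <[x]> is a sum of linear characters; and u permutes the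
    irreducible characters. *)
Lemma sum_irr_expg (gT : finGroupType) (G : {group gT}) (k : nat) (x : gT) :
    x \in G -> coprime k #[x]%g ->
  \sum_i 'chi[G]_i (x ^+ k)%g = \sum_i 'chi[G]_i x.
Proof.
move=> Gx co_k_x; have [u uE] := Qn_aut_exists co_k_x.
rewrite [RHS](reindex_inj (aut_Iirr_inj u)) /=; apply: eq_bigr => i _.
rewrite aut_IirrE cfunE -(cfResE _ _ (cycle_id x)) ?cycle_subG //.
rewrite -(cfResE _ _ (mem_cycle x k)) ?cycle_subG //.
have /char_sum_irr[r ->]: 'Res[<[x]>%g] 'chi[G]_i \is a character.
  by rewrite cfRes_char ?character.irr_char.
rewrite !sum_cfunE rmorph_sum /=; apply: eq_bigr => j _.
have lin_j: 'chi_j \is a linear_char by rewrite irr_cyclic_lin ?cycle_cyclic.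
by rewrite lin_charX ?cycle_id // uE // lin_char_unity_root ?cycle_id.
Qed.

(** Transfer of [sum_irr_expg] from the algebraic numbers to F:
    both sums come from the traces of the same representations rK i over a
    number field K. *)
Lemma sum_irr_mxtrace_expg (F : numClosedFieldType) (gT : finGroupType)
    (G : {group gT}) (sG : irrType F G) (k : nat) (x : gT) :
    x \in G -> coprime k #[x]%g ->
  \sum_(j : sG) \tr (irr_repr j (x ^+ k)%g) = \sum_(j : sG) \tr (irr_repr j x).
Proof.
move=> Gx co_k_x.
pose s := flatten [seq [seq 'Chi_i p.1 p.2.1 p.2.2
                    | p : gT * ('I_(irr_degree (socle_of_Iirr i)) *
                                'I_(irr_degree (socle_of_Iirr i)))]
                  | i : Iirr G].
have s_entry (i : Iirr G) y a b : 'Chi_i y a b \in s.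
  apply/flatten_imageP; exists i => //.
  by apply/imageP; exists (y, (a, b)).
have [K [KC [KF KCs]]] := num_field_embedding s F.
have descend (i : Iirr G) :
    {rK : mx_representation K G (irr_degree (socle_of_Iirr i)) |
      forall y, map_mx KC (rK y) = 'Chi_i y}.
  apply: descend_repr => y a b.
  by have [c Dc] := KCs _ (s_entry i y a b); exists c; apply/eqP.
pose rK i := sval (descend i).
have rKE i y : map_mx KC (rK i y) = 'Chi_i y by rewrite /rK; case: (descend i).
have trK i y : y \in G -> KC (\tr (rK i y)) = 'chi_i y.
  by move=> Gy; rewrite -trace_map_mx rKE -irrRepr cfunE Gy.
(* Absolute irreducibility, unlike irreducibility, is insensitive to the field:
   it goes down from the algebraic numbers to K, then up to F. *)
have abs_irr i : mx_absolutely_irreducible (rK i).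
  rewrite -(map_mx_abs_irr KC); apply: group_closure_closed_field.
  apply: mx_rsim_irr (socle_irr (socle_of_Iirr i)).
  exists 1%:M => // [|y Gy]; first by rewrite row_free_unit unitmx1.
  by rewrite mul1mx mulmx1; apply/esym/rKE.
have sumF y : y \in G ->
    \sum_(j : sG) \tr (irr_repr j y) = KF (\sum_i \tr (rK i y)).
  move=> Gy.
  rewrite (sum_irr_mxtrace sG (rG := fun i => map_repr KF (rK i))) //.
  - by rewrite rmorph_sum; apply: eq_bigr => i _; rewrite trace_map_mx.
  - by apply/pgroupP=> p _ _; rewrite inE /= pchar_num.
  - exact: group_closure_closed_field.
  - by move=> i; apply/mx_abs_irrW; rewrite map_mx_abs_irr.
  - move=> i j eq_ij; apply/irr_inj/cfun_inP => z Gz; rewrite -!trK //.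
    by have /eqP := eq_ij z Gz; rewrite !trace_map_mx fmorph_eq => /eqP->.
  - by rewrite card_ord NirrE.
rewrite !sumF ?groupX //; congr (KF _); apply: (fmorph_inj KC).
rewrite !rmorph_sum /=.
under eq_bigr do rewrite trK ?groupX //.
under [RHS]eq_bigr do rewrite trK //.
exact: sum_irr_expg.
Qed.

Lemma char_col_sum_expg (R : realType) (gT : finGroupType) (G : {group gT})
    (k : nat) (x : gT) :
  x \in G -> coprime k #[x]%g ->
  char_col_sum R G (x ^+ k)%g = char_col_sum R G x.
Proof. exact: sum_irr_mxtrace_expg. Qed.

(** * The scalar character of a faithful representation *)

Section ScalarCharacter.
Variables (R : realType) (gT : finGroupType) (G : {group gT}) (m : nat).
Variable V : mx_representation R[i] G m.

Lemma omegaM : {in rcenter V &, {morph omega V : x y / (x * y)%g >-> x * y}}.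
Proof.
move=> x y Zx Zy; have [m0 | m_gt0] := posnP m.
  (* On the zero module the scalar is the default value 1. *)
  by rewrite /omega insubF ?mulr1 ?m0.
have [Gx Gy] := (subsetP (normal_sub (rcenter_normal V)) x Zx,
                 subsetP (normal_sub (rcenter_normal V)) y Zy).
apply: omega_uniq => //.
by rewrite repr_mxM // (omegaP Zx) (omegaP Zy) scalar_mxM.
Qed.

Lemma omega1 : omega V 1%g = 1.
Proof.
rewrite /omega; case: insubP => [i _ _|//].
by rewrite repr_mx1 mxE eqxx.
Qed.

Lemma omegaX x k : x \in rcenter V -> omega V (x ^+ k)%g = omega V x ^+ k.
Proof.
move=> Zx; elim: k => [|k IHk]; first by rewrite omega1.
by rewrite expgS exprS omegaM ?groupX // IHk.
Qed.

Hypothesis faithV : mx_faithful V.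

Lemma omega_eq1 x : x \in rcenter V -> (omega V x == 1) = (x == 1%g).
Proof.
move=> Zx; apply/eqP/eqP=> [x1 | ->]; last exact: omega1.
apply/set1gP/(subsetP faithV)/rkerP.
by rewrite (omegaP Zx) x1 (subsetP (normal_sub (rcenter_normal V))).
Qed.

Lemma cyclic_rcenter : cyclic (rcenter V).
Proof.
apply: (field_mul_group_cyclic omegaM) => x Zx.
by split=> [/eqP | ->]; [rewrite omega_eq1 // => /eqP | exact: omega1].
Qed.

Lemma omega_primitive x : x \in rcenter V -> #[x]%g.-primitive_root (omega V x).
Proof.
move=> Zx; apply/andP; split; first exact: order_gt0.
apply/forallP=> i; rewrite unity_rootE -omegaX // omega_eq1 ?groupX //.
rewrite -order_dvdn; apply/eqP; apply/idP/eqP=> [x_dv | -> //].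
by apply/eqP; rewrite eqn_leq ltn_ord dvdn_leq.
Qed.

End ScalarCharacter.

(** Two faithful characters of a cyclic group are coprime powers of each other,
    because both map a generator to a primitive root of unity of the same
    order. *)
Lemma omega_coprime_exp (R : realType) (gT : finGroupType) (G : {group gT})
    (dV dW : nat)
    (V : mx_representation R[i] G dV) (W : mx_representation R[i] G dW) :
    mx_faithful V -> mx_faithful W -> rcenter V = rcenter W ->
  exists2 k, coprime #|rcenter V| k
           & {in rcenter V, forall x, omega W x = omega V x ^+ k}.
Proof.
move=> faithV faithW eqZ.
have [z defZ] := cyclicP (cyclic_rcenter faithV).
have Vz : z \in rcenter V by rewrite defZ cycle_id.
have Wz : z \in rcenter W by rewrite -eqZ.
have primV := omega_primitive faithV Vz.
have primW := omega_primitive faithW Wz.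
have [k Dk] := prim_rootP primV (prim_expr_order primW).
exists k => [|x].
  by rewrite defZ -orderE coprime_sym -(prim_root_exp_coprime _ primV) -Dk.
rewrite {1}defZ => /cycleP[a ->].
by rewrite !omegaX // Dk -!exprM mulnC.
Qed.

Theorem theorem4 (R : realType) (gT : finGroupType) (G : {group gT})
    (dV dW : nat)
    (V : mx_representation R[i] G dV) (W : mx_representation R[i] G dW) :
  mx_faithful V -> mx_faithful W -> rcenter V = rcenter W ->
  forall n : nat, growth_coef V n = growth_coef W n.
Proof.
move=> faithV faithW eqZ n.
have [k co_k omegaWV] := omega_coprime_exp faithV faithW eqZ.
rewrite /growth_coef -eqZ; congr (_ * _).
(* As k is coprime to the order of rcenter V, x |-> x ^+ k permutes it; the
   left-hand sum is reindexed along this permutation. *)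
have injX : {in rcenter V &, injective (fun x => x ^+ k)%g}.
  exact: (can_in_inj (expgK co_k)).
have imX : [set (x ^+ k)%g | x in rcenter V] = rcenter V.
  apply/eqP; rewrite eqEcard card_in_imset // leqnn andbT.
  by apply/subsetP=> _ /imsetP[x Zx ->]; rewrite groupX.
rewrite -{1}imX big_imset //=; apply: eq_bigr => x Zx.
have Gx := subsetP (normal_sub (rcenter_normal V)) x Zx.
have co_kx : coprime k #[x]%g.
  by rewrite coprime_sym; apply: coprime_dvdl (order_dvdG Zx) co_k.
by rewrite (omegaX _ Zx) (omegaWV _ Zx) (char_col_sum_expg R Gx co_kx).
Qed.
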